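(* Let $H$ be the graph with vertex set $V(H)=\{0,1,\ldots,8\}$ and edge set \[ E(H)=\{02,04,07,08,13,14,16,17,23,25,27,35,36,46,47,56\}, \] where $ij$ denotes the edge $\{i,j\}$. Then $Z^+_{(1)}(H)=4$.
   Context: PSD color-change rule on a finite simple graph $X$: let $B\subseteq V(X)$ be the current set of blue vertices (all others are white), and let $C$ be the vertex set of a connected component of $X-B$. A blue vertex $x\in B$ may PSD-force a vertex $y\in C$ (turn $y$ blue) when $N_X(x)\cap C=\{y\}$. Forces are applied one after another, recomputing the components of the white graph after each force. A leak is a vertex that is forbidden to perform a force. A set $B\subseteq V(X)$ is a $1$-leaky PSD forcing set of $X$ if, for every choice of a single leak $\lambda\in V(X)$, starting from the initial blue set $B$ there is a sequence of PSD forces, none performed by $\lambda$, after which all vertices of $X$ are blue. $Z^+_{(1)}(X)$ denotes the minimum size of a $1$-leaky PSD forcing set of $X$. *)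

(* Defs.v *)
From mathcomp Require Import all_boot.

Set Implicit Arguments.
Unset Strict Implicit.
Unset Printing Implicit Defensive.

Record sgraph := SGraph {
  vertex :> finType;
  adj : rel vertex;
  adj_sym : symmetric adj;
  adj_irrefl : irreflexive adj }.

Definition neighbors (X : sgraph) (x : X) : {set X} := [set y | adj x y].

Definition white_adj (X : sgraph) (B : {set X}) : rel X :=
  [rel u v | [&& u \notin B, v \notin B & adj u v]].

(* The vertex sets of the connected components of X - B. *)
Definition white_components (X : sgraph) (B : {set X}) : {set {set X}} :=
  equivalence_partition (connect (white_adj B)) (~: B).

Definition psd_force (X : sgraph) (B : {set X}) (x y : X) : bool :=
  (x \in B) &&
  [exists C in white_components B, neighbors x :&: C == [set y]].

Definition psd_step (X : sgraph) (leak : X) : rel {set X} :=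
  [rel B B' | [exists x, exists y,
     [&& x != leak, psd_force B x y & B' == y |: B]]].

(* connect is reachability by a finite, possibly empty, sequence of steps. *)
Definition one_leaky_psd_forcing (X : sgraph) (B : {set X}) : bool :=
  [forall leak : X, connect (psd_step leak) B [set: X]].

(* So the default value in the arg min below does satisfy its predicate. *)
Lemma one_leaky_psd_forcing_setT (X : sgraph) :
  one_leaky_psd_forcing [set: X].
Proof. by apply/forallP=> leak; apply: connect0. Qed.

Definition Zplus1 (X : sgraph) : nat :=
  #|[arg min_(B < [set: X] | one_leaky_psd_forcing B) #|B|]|.

Definition H_edges : seq (nat * nat) :=
  [:: (0, 2); (0, 4); (0, 7); (0, 8); (1, 3); (1, 4); (1, 6); (1, 7);
      (2, 3); (2, 5); (2, 7); (3, 5); (3, 6); (4, 6); (4, 7); (5, 6)].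

Definition H_adj : rel 'I_9 :=
  [rel i j | ((val i, val j) \in H_edges) || ((val j, val i) \in H_edges)].

Lemma H_adj_sym : symmetric H_adj.
Proof. by move=> i j; rewrite /H_adj /= orbC. Qed.

Lemma H_adj_irrefl : irreflexive H_adj.
Proof. by case; do 9![case=> //]. Qed.

Definition H : sgraph := SGraph H_adj_sym H_adj_irrefl.

(* Main.v *)
(** Lower bound: let W be connected, and suppose that at most one vertex outside
    W has exactly one neighbour in W.  Making that vertex the leak, a blue set
    disjoint from W stays so forever, since a white component meeting W contains
    it.  Hence every 1-leaky forcing set meets W.  For H this applies to {8},
    {3,5}, {0,2,4,6}, {1,2,4,7}, {1,3,6,7} and {1,5,6,7}, and no three vertices
    meet all six: 8 and one of 3, 5 are needed, but
    {0,2,4,6}, {1,2,4,7}, {1,5,6,7} (which all avoid 3) have no common vertex,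
    nor have {0,2,4,6}, {1,2,4,7}, {1,3,6,7} (which all avoid 5).
    Upper bound: {2,3,6,8} is 1-leaky forcing. *)
Require Import Defs.
From mathcomp Require Import all_boot.

Lemma white_adj_sym (X : sgraph) (B : {set X}) : symmetric (white_adj B).
Proof. by move=> u v; rewrite /white_adj /= adj_sym andbCA. Qed.

(** The component in which [x] forces [y] contains [y], so it is the class of [y] and need not be
    quantified over. *)
Lemma psd_forceP (X : sgraph) (B : {set X}) (x y : X) :
  reflect [/\ x \in B, y \notin B, adj x y &
            forall z, connect (white_adj B) y z -> adj x z -> z = y]
          (psd_force B x y).
Proof.
(* Each step of [white_adj] ends in a white vertex, so membership in [~: B] is automatic. *)
have memC u z : u \notin B ->
  (z \in [set v in ~: B | connect (white_adj B) u v])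
    = connect (white_adj B) u z.
  move=> uB; rewrite !inE andb_idl //.
  case/connectP=> p + ->; elim: p u uB => //= v p IHp u uB.
  by case/andP=> /and3P[_ vB _]; apply: IHp.
apply: (iffP andP) => -[xB].
- case/exists_inP=> C /imsetP[u]; rewrite inE => uB -> /eqP NC.
  have: y \in [set y] by rewrite set11.
  rewrite -{1}NC !inE => /and3P[xy yB uy]; split=> // z yz xz.
  apply/set1P; rewrite -NC in_setI memC // (connect_trans uy yz) andbT.
  by rewrite inE.
- move=> yB xy N1; split=> //.
  apply/exists_inP; exists [set v in ~: B | connect (white_adj B) y v].
    by apply: imset_f; rewrite inE.
  apply/eqP/setP=> z; rewrite in_setI memC // in_set1 inE.
  by apply/andP/eqP=> [[xz yz]|->]; [apply: N1 | split; last exact: connect0].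
Qed.

Lemma white_path_connect (X : sgraph) (B : {set X}) (x : X) (p : seq X) :
  path (@adj X) x p -> {in x :: p, forall z, z \notin B} ->
  {in x :: p &, forall y z, connect (white_adj B) y z}.
Proof.
move=> adjp pB; have xp z : z \in x :: p -> connect (white_adj B) x z.
  apply: (@path_connect _ (white_adj B)).
  elim: p x adjp pB => //= y p IHp x /andP[xy yp] pB.
  rewrite /white_adj /= xy !pB ?inE ?eqxx ?orbT //=.
  by apply: IHp => // w wp; apply: pB; rewrite inE wp orbT.
move=> y z /xp + /xp; rewrite (sym_connect_sym (white_adj_sym X B)).
exact: connect_trans.
Qed.

(** Connectedness of W is witnessed by a path through all its vertices, so for a concrete graph it
    is checked by computation. *)
Lemma leaky_fort (X : sgraph) (leak x : X) (p : seq X) (B : {set X}) :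
    path (@adj X) x p -> uniq (x :: p) ->
    (forall z, z != leak -> z \notin x :: p -> count (adj z) (x :: p) != 1) ->
  one_leaky_psd_forcing B -> has (mem B) (x :: p).
Proof.
move=> adjp Up fort /forallP/(_ leak)/connectP[q].
set s := x :: p in Up fort *; have [//|] := boolP (has (mem B) s).
elim: q B => [|B' q IHq] B Bs.
  by move=> _ /= BT; rewrite -BT /s /= inE in Bs.
rewrite [path _ _ _]/= => /andP[/existsP[u /existsP[y]]].
case/and3P=> uleak /psd_forceP[uB yB uy Nu] /eqP-> pathq.
move=> lastq; apply: IHq pathq lastq.
have sB : {in s, forall z, z \notin B} by apply/hasPn.
have ys : y \notin s.
  apply/negP=> ys.
  have us : u \notin s by apply: contraL uB => /sB.
  have /negP[] := fort u uleak us.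
  (* All of W lies in the white component of [y], so [y] would be the only neighbour of [u] in W. *)
  rewrite (@eq_in_count _ _ (pred1 y)) ?count_uniq_mem ?ys // => z zs /=.
  by apply/idP/eqP=> [|-> //]; apply: Nu; apply: white_path_connect zs.
by apply/hasPn=> z zs; rewrite /= !inE negb_or sB // andbT;
  apply: contraNneq ys => <-.
Qed.

(* [run e leak b c] checks the forces listed in [c], starting from the blue set
   [b]; [e] enumerates the vertices.  An entry [(x, y, D)] is the force of [y]
   by [x], where [D] is a union of white components containing [y] in which [y]
   is the only neighbour of [x]. *)
Fixpoint run (X : sgraph) (e : seq X) (leak : X) (b : seq X)
    (c : seq (X * X * seq X)) : bool :=
  if c is (x, y, D) :: c' then
    [&& x != leak, x \in b, y \notin b, adj x y, y \in D,
        all (fun u => all (fun v => adj u v ==> (v \in b) || (v \in D)) e) D,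
        all (fun z => adj x z ==> (z == y)) D
      & run X e leak (y :: b) c']
  else all (mem b) e.

Lemma run_connect (X : sgraph) (e : seq X) (leak : X) b c :
  e =i X -> run X e leak b c ->
  connect (psd_step leak) [set z in b] [set: X].
Proof.
move=> eX; elim: c b => [|[[x y] D] c IHc] b /=.
  move/allP=> eb; rewrite (_ : [set z in b] = setT) ?connect0 //.
  by apply/setP=> z; rewrite !inE; apply: eb; rewrite eX.
case/and5P=> xleak xb yb xy /and4P[yD /allP Dclosed /allP Dx /IHc].
apply: connect_trans; apply: connect1.
apply/existsP; exists x; apply/existsP; exists y.
rewrite xleak set_cons eqxx andbT /=.
apply/psd_forceP; split; rewrite ?inE // => z yz xz.
suff zD : z \in D by apply/eqP; have:= Dx z zD; rewrite xz.
(* Edges leave [D] only towards blue vertices, so a white path from [y] stays in [D]. *)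
case/connectP: yz => q + ->; elim: q y yD {yb xy Dx IHc} => //= v q IHq u uD.
case/andP=> /and3P[_ vb uv] vq; apply: IHq vq.
have /allP/(_ v) := Dclosed u uD; rewrite eX uv => /(_ isT).
by rewrite inE in vb; rewrite (negPf vb).
Qed.

Notation "''v' k" := (@Ordinal 9 k isT) (at level 8, k at level 2).

Definition H_vertices : seq H :=
  [:: 'v0; 'v1; 'v2; 'v3; 'v4; 'v5; 'v6; 'v7; 'v8].

Lemma mem_H_vertices : H_vertices =i H.
Proof. by case; do 9![case=> //]. Qed.

Lemma H_forcing_set :
  one_leaky_psd_forcing (X := H) [set z in [:: 'v2; 'v3; 'v6; 'v8]].
Proof.
(* Only 1, 2, 3 and 6 force here, so this serves every other leak. *)
pose generic : seq (H * H * seq H) :=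
  [:: ('v3, 'v1, [:: 'v0; 'v1; 'v4; 'v7]); ('v6, 'v4, [:: 'v0; 'v4; 'v7]);
      ('v1, 'v7, [:: 'v0; 'v7]); ('v2, 'v0, [:: 'v0]); ('v2, 'v5, [:: 'v5])].
pose c (leak : H) : seq (H * H * seq H) :=
  match val leak with
  | 1 =>
    [:: ('v3, 'v1, [:: 'v0; 'v1; 'v4; 'v7]); ('v6, 'v4, [:: 'v0; 'v4; 'v7]);
        ('v8, 'v0, [:: 'v0; 'v7]); ('v0, 'v7, [:: 'v7]); ('v2, 'v5, [:: 'v5])]
  | 2 =>
    [:: ('v3, 'v1, [:: 'v0; 'v1; 'v4; 'v7]); ('v6, 'v4, [:: 'v0; 'v4; 'v7]);
        ('v1, 'v7, [:: 'v0; 'v7]); ('v4, 'v0, [:: 'v0]); ('v3, 'v5, [:: 'v5])]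
  | 3 =>
    [:: ('v8, 'v0, [:: 'v0; 'v1; 'v4; 'v7]); ('v2, 'v7, [:: 'v1; 'v4; 'v7]);
        ('v0, 'v4, [:: 'v1; 'v4]); ('v4, 'v1, [:: 'v1]); ('v2, 'v5, [:: 'v5])]
  | 6 =>
    [:: ('v3, 'v1, [:: 'v0; 'v1; 'v4; 'v7]); ('v8, 'v0, [:: 'v0; 'v4; 'v7]);
        ('v2, 'v7, [:: 'v4; 'v7]); ('v0, 'v4, [:: 'v4]); ('v2, 'v5, [:: 'v5])]
  | _ => generic
  end.
apply/forallP=> leak; apply: (run_connect H H_vertices leak _ (c leak)) => //.
  exact: mem_H_vertices.
by case: leak; do 9![case=> //].
Qed.

Lemma H_lower_bound (B : {set H}) : one_leaky_psd_forcing B -> 4 <= #|B|.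
Proof.
move=> forceB.
have fort (leak x : H) p : path (@adj H) x p -> uniq (x :: p) ->
    all (fun z => [|| z == leak, z \in x :: p | count (adj z) (x :: p) != 1])
        H_vertices ->
    has (mem B) (x :: p).
  move=> adjp Up /allP lf; apply: (leaky_fort _ leak) => // z zleak zp.
  by have := lf z; rewrite mem_H_vertices (negPf zleak) (negPf zp); apply.
(* In each call the leak is the one outside vertex with exactly one neighbour in the set. *)
have := fort 'v0 'v8 [::] isT isT isT.
have := fort 'v1 'v3 [:: 'v5] isT isT isT.
have := fort 'v8 'v2 [:: 'v0; 'v4; 'v6] isT isT isT.
have := fort 'v5 'v1 [:: 'v4; 'v7; 'v2] isT isT isT.
have := fort 'v0 'v3 [:: 'v6; 'v1; 'v7] isT isT isT.
have := fort 'v0 'v5 [:: 'v6; 'v1; 'v7] isT isT isT.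
have <- : count (mem B) H_vertices = #|B|.
  have U : uniq [seq z <- H_vertices | z \in B] by apply: filter_uniq.
  rewrite -size_filter -(card_uniqP U); apply: eq_card => z.
  by rewrite mem_filter mem_H_vertices andbT.
(* What remains is a statement about nine booleans, decided by cases. *)
rewrite /=; move: ('v0 \in B) ('v1 \in B) ('v2 \in B) ('v3 \in B) ('v4 \in B)
  ('v5 \in B) ('v6 \in B) ('v7 \in B) ('v8 \in B).
by do 9!case.
Qed.

Theorem proposition10 : Zplus1 H = 4.
Proof.
rewrite /Zplus1; case: arg_minnP => [|B forceB minB].
  exact: one_leaky_psd_forcing_setT.
apply/eqP; rewrite eqn_leq H_lower_bound // andbT.
apply: leq_trans (minB _ H_forcing_set) _.
by rewrite cardsE card_size.
Qed.
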